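(* Let $K$ be any infinite field. For all $n_1,n_2,n_3\in\mathbb{N}$ the generic subrank of tensors in $K^{n_1}\otimes K^{n_2}\otimes K^{n_3}$ is $$Q(n_1,n_2,n_3)=\min\left\{n_1,n_2,n_3,\left\lfloor\sqrt{n_1+n_2+n_3-2}\right\rfloor\right\}.$$
   Context: $\mathbb{N}$ denotes the positive integers. Write $K^{n_1,\dots,n_k}:=K^{n_1}\otimes\cdots\otimes K^{n_k}$. For tensors $S\in K^{m_1,\dots,m_k}$ and $T\in K^{n_1,\dots,n_k}$ write $S\le T$ if there are linear maps $A_i:K^{n_i}\to K^{m_i}$ with $(A_1\otimes\cdots\otimes A_k)T=S$. For $s\ge 0$ let $I_s=\sum_{j=1}^s e_j\otimes\cdots\otimes e_j$ ($k$ factors, $e_1,\dots,e_s$ the standard basis of $K^s$) be the unit tensor of size $s$. The subrank $Q(T)$ of $T\in K^{n_1,\dots,n_k}$ is the largest integer $s\ge 0$ with $I_s\le T$. Let $\mathcal{C}_r^{(n_1,\dots,n_k)}=\{T\in K^{n_1,\dots,n_k} : Q(T)\ge r\}$. The generic subrank $Q(n_1,\dots,n_k)$ is the largest $r$ such that $\mathcal{C}_r^{(n_1,\dots,n_k)}$ is Zariski-dense in $K^{n_1,\dots,n_k}$. *)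

(* Defs.v *)
From Stdlib Require Import PeanoNat.
From mathcomp Require Import all_boot all_order all_algebra.
From mathcomp Require Import mpoly ring.

Set Implicit Arguments.
Unset Strict Implicit.
Unset Printing Implicit Defensive.

Import GRing.Theory.
Local Open Scope ring_scope.

Definition infinite_field (K : fieldType) : Prop :=
  forall s : seq K, exists x : K, x \notin s.

Definition is_largest (P : nat -> Prop) (m : nat) : Prop :=
  P m /\ forall n, P n -> (n <= m)%N.

(* The affine space K^I, for a finite index type I: its coordinates are listed
   in the order of the enumeration of I. *)

Definition coords (K : fieldType) (I : finType) (x : {ffun I -> K})
  : 'I_#|I| -> K := fun i => x (enum_val i).

Definition zariski_closed (K : fieldType) (I : finType)
    (Z : {ffun I -> K} -> Prop) : Prop :=
  exists S : {mpoly K[#|I|]} -> Prop,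
    forall x, Z x <-> (forall p, S p -> p.@[coords x] = 0).

Definition zariski_dense (K : fieldType) (I : finType)
    (C : {ffun I -> K} -> Prop) : Prop :=
  forall Z : {ffun I -> K} -> Prop,
    zariski_closed Z -> (forall x, C x -> Z x) -> forall x, Z x.

(* K^n1 (x) K^n2 (x) K^n3, in coordinates with respect to the basis of the
   e_i (x) e_j (x) e_k. *)
Notation tensor K n1 n2 n3 := {ffun 'I_n1 * 'I_n2 * 'I_n3 -> K}.

Definition pure_tensor (K : fieldType) (n1 n2 n3 : nat)
    (u : 'cV[K]_n1) (v : 'cV[K]_n2) (w : 'cV[K]_n3) : tensor K n1 n2 n3 :=
  [ffun i => u i.1.1 0 * v i.1.2 0 * w i.2 0].

(* The map A1 (x) A2 (x) A3; see tensor_map_pure. *)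
Definition tensor_map (K : fieldType) (m1 m2 m3 n1 n2 n3 : nat)
    (A1 : 'M[K]_(m1, n1)) (A2 : 'M[K]_(m2, n2)) (A3 : 'M[K]_(m3, n3))
    (T : tensor K n1 n2 n3) : tensor K m1 m2 m3 :=
  [ffun i => \sum_(j : 'I_n1 * 'I_n2 * 'I_n3)
               A1 i.1.1 j.1.1 * A2 i.1.2 j.1.2 * A3 i.2 j.2 * T j].

Lemma tensor_map_pure (K : fieldType) (m1 m2 m3 n1 n2 n3 : nat)
    (A1 : 'M[K]_(m1, n1)) (A2 : 'M[K]_(m2, n2)) (A3 : 'M[K]_(m3, n3))
    (u : 'cV[K]_n1) (v : 'cV[K]_n2) (w : 'cV[K]_n3) :
  tensor_map A1 A2 A3 (pure_tensor u v w)
    = pure_tensor (A1 *m u) (A2 *m v) (A3 *m w).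
Proof.
apply/ffunP=> i; rewrite !ffunE !mxE big_distrlr /=.
rewrite (pair_bigA _ (fun a b => A1 i.1.1 a * u a 0 * (A2 i.1.2 b * v b 0))).
rewrite big_distrlr /= pair_bigA; apply: eq_bigr => -[[a b] c] _ /=.
by rewrite ffunE /=; ring.
Qed.

Definition tensor_le (K : fieldType) (m1 m2 m3 n1 n2 n3 : nat)
    (S : tensor K m1 m2 m3) (T : tensor K n1 n2 n3) : Prop :=
  exists (A1 : 'M[K]_(m1, n1)) (A2 : 'M[K]_(m2, n2)) (A3 : 'M[K]_(m3, n3)),
    tensor_map A1 A2 A3 T = S.

Definition unit_tensor (K : fieldType) (s : nat) : tensor K s s s :=
  \sum_(j < s) pure_tensor (delta_mx j 0) (delta_mx j 0) (delta_mx j 0).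

Definition is_subrank (K : fieldType) (n1 n2 n3 : nat)
    (T : tensor K n1 n2 n3) (q : nat) : Prop :=
  is_largest (fun s => tensor_le (unit_tensor K s) T) q.

Definition subrank_ge (K : fieldType) (n1 n2 n3 r : nat)
    (T : tensor K n1 n2 n3) : Prop :=
  exists2 q, is_subrank T q & (r <= q)%N.

Definition is_generic_subrank (K : fieldType) (n1 n2 n3 q : nat) : Prop :=
  is_largest (fun r => zariski_dense (@subrank_ge K n1 n2 n3 r)) q.

(* Main.v *)
Require Import Defs.
From Stdlib Require Import PeanoNat Classical.
From mathcomp Require Import all_boot all_order all_algebra.
From mathcomp Require Import mpoly ring zify.

(** Write [r] for a candidate subrank and [N = n1 * n2 * n3].

    Upper bound. The bound [r <= n_i] holds because a restriction to the unit
    tensor [I_r] forces the three matrices to have independent rows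
    ([tensor_map_unit_row_free]).  For the square root, suppose that
    [(A1 (x) A2 (x) A3) T = I_r].  Choosing [r] pivot columns in each [A_d] and
    clearing them by the inverse [G_d] of the pivot minor shows that the entries
    of [T] at the [r ^ 3] pivot positions are a polynomial in the other entries
    of [T], in the non-pivot columns of the [G_d A_d], and in the columns of the
    [G_d], which only enter through a sum of [r] rank-one tensors
    ([tensor_le_unit_chart]).  A rank-one tensor can be scaled so that two of its
    coordinates are [1], which saves [2 r] parameters, and what remains is
    [N + r (n1 + n2 + n3 - 2 - r ^ 2)] parameters.  When this is less than [N],
    the [N] coordinates of [T] are algebraically dependent, by counting monomials
    ([algebraic_dependence]).  Multiplying the relations over the finitely many
    choices of pivots gives a nonzero polynomial that vanishes on all tensors of
    subrank at least [r] ([subrank_ge_not_dense]).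

    Lower bound, linear algebra.  Let [X] have [I_r] in its leading
    [r x r x r] corner.  Moving [X] by infinitesimal changes of basis and by
    changes outside the corner reaches every direction as soon as the slices of
    [X], cut to the corner, span [K^(r x r x r)] when each is tensored with all
    of [K^r] in its own direction.  Dually: a tensor [U] orthogonal to all these
    products must vanish ([nondegenerate]).  The first [r] slices of each
    direction are the [E_cc], so they kill the entries of [U] whose indices are
    not distinct, and [n_d - r] slices are free in direction [d], together at
    least [(r - 1)(r - 2)].

    To choose them, read indices in [Z/r] and give the entry [(i, j, k)] the
    shape [(j - i, k - i)].  There are [(r - 1)(r - 2)] shapes with distinct
    indices.  A slice supported on one diagonal [q - p = c] sees only the shapes
    of one line, and the lines form three parallel classes, [b - a = c],
    [b = c] and [a = c] on shapes [(a, b)].  If [m] slices on that diagonal carry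
    the powers [y_p ^ t], [t < m], of distinct scalars, the Vandermonde
    determinant makes [U] vanish on the whole line once at most [m] of its shapes
    are not known to vanish.  It is thus enough to cover all shapes by lines, one
    after the other, paying for a line the number of its uncovered shapes, with
    budget [s_d = n_d - r] in direction [d].  This greedy procedure never gets
    stuck: if every uncovered shape lay on lines with more than [s_d] uncovered
    shapes in all three directions, there would be at least
    [(s_d + 1)(s_e + 1)] uncovered shapes for any [d != e], more than the
    [s_0 + s_1 + s_2] that are left to pay for ([short_line_exists],
    [line_quotas]).

    Lower bound, density.  Through such an [X] there is, for each tangent
    direction [w], a polynomial curve [X + e w + O(e ^ 2)] that consists of
    tensors of subrank at least [r], apart from finitely many [e].  If a nonzero
    polynomial vanished on them, then so would the lowest homogeneous part of
    its expansion at [X], at every [w]; this is impossible over an infinite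
    field ([dense_of_tangent_curves]).  The argument works in any
    characteristic, where a comparison of differentials would need care. *)

Set Implicit Arguments.
Unset Strict Implicit.
Unset Printing Implicit Defensive.

Import GRing.Theory.
Local Open Scope ring_scope.

(** * Polynomials over an infinite field *)

Lemma infinite_uniq_seq (K : fieldType) (n : nat) :
  infinite_field K -> exists2 s : seq K, uniq s & size s = n.
Proof.
move=> hK; elim: n => [|n [s us ss]]; first by exists [::].
by have [x xs] := hK s; exists (x :: s); rewrite /= ?xs ?ss.
Qed.

Lemma infinite_nonroot (K : fieldType) (p : {poly K}) :
  infinite_field K -> p != 0 -> exists x, p.[x] != 0.
Proof.
move=> hK p0; apply: NNPP => nex.
have rt x : root p x.
  by apply/negPn/negP => /negP nr; apply: nex; exists x; apply/negP => r; apply: nr.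
have [s us ss] := infinite_uniq_seq (size p) hK.
have : (size s < size p)%N by apply: max_poly_roots us => //; apply/allP => x _; apply: rt.
by rewrite ss ltnn.
Qed.

Lemma base_expansion_inj (B n : nat) (a b : 'I_n -> nat) :
  (forall i, a i < B)%N -> (forall i, b i < B)%N ->
  (\sum_i a i * B ^ i = \sum_i b i * B ^ i)%N -> a =1 b.
Proof.
elim: n a b => [|n IH] a b ha hb; first by move=> _ [].
rewrite !big_ord_recl /= !expn0 !muln1.
have pull (c : 'I_n.+1 -> nat) : (\sum_(i < n) c (lift ord0 i) * B ^ bump 0 i =
    B * \sum_(i < n) c (lift ord0 i) * B ^ i)%N.
  by rewrite big_distrr; apply: eq_bigr => i _; rewrite /bump /= add1n expnS mulnCA.
rewrite !pull => e.
have e0 : a ord0 = b ord0.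
  have := congr1 (modn^~ B) e; rewrite /= !(mulnC B).
  by rewrite ![(_ ord0 + _)%N]addnC !modnMDl !modn_small.
have B0 : (0 < B)%N by apply: leq_ltn_trans (ha ord0).
have e1 : (\sum_(i < n) a (lift ord0 i) * B ^ i = \sum_(i < n) b (lift ord0 i) * B ^ i)%N.
  by move/eqP: e; rewrite e0 eqn_add2l eqn_pmul2l // => /eqP.
have := IH _ _ (fun i => ha _) (fun i => hb _) e1 => ab i.
by case: (unliftP ord0 i) => [j|] ->.
Qed.

(** Kronecker substitution: with [B] larger than all exponents of [p], the
    substitution of ['X^(B ^ i)] for the [i]-th variable keeps distinct monomials
    of [p] distinct, which reduces the claim to one variable. *)
Lemma mpoly_nonvanishing (K : fieldType) (n : nat) (p : {mpoly K[n]}) :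
  infinite_field K -> p != 0 -> exists x, p.@[x] != 0.
Proof.
move=> hK p0; pose B := msize p; pose e (m : 'X_{1..n}) := (\sum_i m i * B ^ i)%N.
have small m : m \in msupp p -> forall i, (m i < B)%N.
  move=> /msize_mdeg_lt h i; apply: leq_ltn_trans h.
  by rewrite mdegE (bigD1 i) //= leq_addr.
pose q : {poly K} := \sum_(m <- msupp p) p@_m *: 'X^(e m).
have ev t : q.[t] = p.@[fun i : 'I_n => t ^+ (B ^ i)].
  rewrite mevalE horner_sum; apply: eq_bigr => m _.
  rewrite hornerZ hornerXn /e -prodrXr; congr (_ * _); apply: eq_bigr => i _.
  by rewrite -exprM mulnC.
have [|t qt] := @infinite_nonroot K q hK; last first.
  by exists (fun i : 'I_n => t ^+ (B ^ i)); rewrite -ev.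
have [m0 m0p] : exists m, m \in msupp p by exists (mlead p); apply: mlead_supp.
apply/eqP => /(congr1 (coefp (e m0))) /=; rewrite coef0 coef_sum.
rewrite (bigD1_seq m0) //= coefZ coefXn eqxx mulr1 big1_seq ?addr0.
  by apply/eqP; rewrite -mcoeff_msupp.
move=> m /andP[mm0 mp]; rewrite coefZ coefXn; case: eqP; rewrite ?mulr0 //= => ee.
case/eqP: mm0; apply/mnmP; apply: base_expansion_inj (small _ mp) (small _ m0p) _.
exact: esym ee.
Qed.

(** There are [d ^ n] monomials in [f] with exponents below [d], and they lie in
    a space spanned by [O(d) ^ N] monomials in the [N] variables; for [d] large,
    [N < n] makes them linearly dependent. *)
Lemma algebraic_dependence (K : fieldType) (n N : nat) (f : 'I_n -> {mpoly K[N]}) :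
  (N < n)%N -> exists2 P : {mpoly K[n]}, P != 0 & forall y, P.@[fun i => (f i).@[y]] = 0.
Proof.
move=> Nn; have [D hD] : exists D, forall i, (msize (f i) + 2 <= D)%N.
  by exists (\max_i msize (f i) + 2)%N => i; rewrite leq_add2r; apply: (leq_bigmax i).
pose d := ((n * D).+1 ^ N).+1; pose E := (d * (n * D).+1)%N.
have d0 : (0 < d)%N by [].
pose mon (m : {ffun 'I_n -> 'I_d}) : 'X_{1..n} := [multinom (m i : nat) | i < n].
pose F (m : {ffun 'I_n -> 'I_d}) := \prod_i f i ^+ m i.
have sizeX i k : (msize (f i ^+ k) <= (k * D).+1)%N.
  elim: k => [|k IH]; first by rewrite expr0 msize1.
  rewrite exprS; apply: leq_trans (msizeM_le _ _) _.
  move: IH (hD i); rewrite mulSn; lia.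
have sizeF m : (msize (F m) <= E)%N.
  have -> : E = (d + d * (n * D))%N by rewrite /E mulnS.
  apply: (@leq_trans (\sum_(i < n) (d * D)).+1); last first.
    by rewrite sum_nat_const card_ord mulnCA -addn1 addnC leq_add2r.
  rewrite /F; elim/big_rec2: _ => [|i x p _ hp]; first by rewrite msize1.
  apply: leq_trans (msizeM_le _ _) _.
  have : (msize (f i ^+ m i) < d * D)%N.
    apply: leq_ltn_trans (sizeX i (m i)) _.
    apply: (@leq_trans ((m i).+1 * D)); last by rewrite leq_mul2r ltn_ord orbT.
    by have := hD i; rewrite mulSn; lia.
  by move: hp; lia.
pose C := \matrix_(r < #|{: {ffun 'I_n -> 'I_d}}|, c < #|{: {ffun 'I_N -> 'I_E}}|)
   (F (enum_val r))@_[multinom (enum_val c i : nat) | i < N].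
have : ~~ row_free C.
  rewrite /row_free neq_ltn; apply/orP; left; apply: leq_ltn_trans (rank_leq_col _) _.
  rewrite !card_ffun !card_ord /E expnMn.
  (* [d] exceeds [(n * D + 1) ^ N], so one spare factor [d] beats the constant. *)
  apply: (@leq_trans (d ^ N.+1)); last by rewrite leq_pexp2l.
  by rewrite expnSr ltn_pmul2l ?expn_gt0 // ltnS.
rewrite -kermx_eq0 => /rowV0Pn[v /sub_kermxP vC v0].
pose P : {mpoly K[n]} := \sum_(m : {ffun 'I_n -> 'I_d}) v 0 (enum_rank m) *: 'X_[mon m].
have coefP m : P@_(mon m) = v 0 (enum_rank m).
  rewrite /P raddf_sum (bigD1 m) //= mcoeffZ mcoeffX eqxx mulr1 big1 ?addr0 // => m' m'm.
  rewrite mcoeffZ mcoeffX; case: eqP => [e|]; last by rewrite mulr0.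
  case/eqP: m'm; apply/ffunP => i; apply: val_inj.
  by have := congr1 (fun x : 'X_{1..n} => x i) e; rewrite !mnmE.
exists P.
  apply: contraNneq v0 => P0; apply/eqP/rowP => r.
  by rewrite -(enum_valK r) -coefP P0 mcoeff0 mxE.
have comb0 : \sum_m v 0 (enum_rank m) *: F m = 0.
  apply/mpolyP => a; rewrite mcoeff0 raddf_sum /=.
  case: (boolP [forall i, a i < E]%N) => [/forallP aE|]; last first.
    rewrite negb_forall => /existsP[i ai]; apply: big1 => m _.
    rewrite mcoeffZ memN_msupp_eq0 ?mulr0 //; apply: msize_mdeg_ge.
    apply: leq_trans (sizeF m) _; rewrite mdegE (bigD1 i) //=.
    by rewrite -leqNgt in ai; apply: leq_trans ai (leq_addr _ _).
  pose c := enum_rank [ffun i => Ordinal (aE i)].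
  have /rowP/(_ c) := vC; rewrite !mxE => vC0; rewrite -[RHS]vC0.
  rewrite [RHS](reindex_onto enum_rank enum_val) => [|r _]; last exact: enum_valK.
  rewrite [RHS](eq_bigl xpredT) => [|m]; last by rewrite /= enum_rankK eqxx.
  apply: eq_bigr => m _; rewrite mcoeffZ mxE !enum_rankK; congr (_ * _@__).
  by apply/mnmP => i; rewrite mnmE ffunE.
move=> y; rewrite /P raddf_sum /= -[RHS](meval0 y) -comb0 raddf_sum /=.
apply: eq_bigr => m _; rewrite !mevalZ mevalX /F rmorph_prod /=; congr (_ * _).
by apply: eq_bigr => i _; rewrite mnmE rmorphXn.
Qed.

(** * Unit tensors and restrictions *)

Lemma unit_tensorE (K : fieldType) (s : nat) (i j k : 'I_s) :
  unit_tensor K s (i, j, k) = ((i == j) && (j == k))%:R.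
Proof.
rewrite /unit_tensor sum_ffunE (bigD1 j) //= ffunE /= !mxE !eqxx big1 => [|l lj].
  by rewrite addr0 !andbT mulr1 -natrM mulnb (eq_sym j).
by rewrite ffunE /= !mxE [j == l]eq_sym (negbTE lj) !(mulr0, mul0r).
Qed.

Lemma tensor_map_comp (K : fieldType) (l1 l2 l3 m1 m2 m3 n1 n2 n3 : nat)
    (B1 : 'M[K]_(l1, m1)) (B2 : 'M[K]_(l2, m2)) (B3 : 'M[K]_(l3, m3))
    (A1 : 'M[K]_(m1, n1)) (A2 : 'M[K]_(m2, n2)) (A3 : 'M[K]_(m3, n3))
    (T : tensor K n1 n2 n3) :
  tensor_map B1 B2 B3 (tensor_map A1 A2 A3 T)
    = tensor_map (B1 *m A1) (B2 *m A2) (B3 *m A3) T.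
Proof.
apply/ffunP => x; rewrite !ffunE.
under eq_bigr do rewrite ffunE big_distrr /=.
rewrite exchange_big; apply: eq_bigr => y _ /=; rewrite !mxE.
rewrite big_distrlr /= (pair_bigA _ (fun a b => B1 _ a * A1 a _ * (B2 _ b * A2 b _))).
rewrite big_distrlr /= pair_bigA big_distrl; apply: eq_bigr => -[[a b] c] _ /=.
by ring.
Qed.

Lemma tensor_map_unit (K : fieldType) (s m1 m2 m3 : nat)
    (B1 : 'M[K]_(m1, s)) (B2 : 'M[K]_(m2, s)) (B3 : 'M[K]_(m3, s)) x :
  tensor_map B1 B2 B3 (unit_tensor K s) x = \sum_l B1 x.1.1 l * B2 x.1.2 l * B3 x.2 l.
Proof.
rewrite ffunE.
rewrite (bigID [pred j : 'I_s * 'I_s * 'I_s | (j.1.1 == j.1.2) && (j.1.2 == j.2)]) /=.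
rewrite [X in _ + X]big1 ?addr0 => [|[[a b] c] /=]; last first.
  by rewrite unit_tensorE => /negbTE->; rewrite mulr0.
rewrite (reindex_onto (fun l : 'I_s => (l, l, l)) (fun j => j.2)) => [|[[a b] c] /=]; last first.
  by case/andP => /eqP-> /eqP->.
by apply: eq_big => l /=; rewrite ?eqxx // unit_tensorE !eqxx mulr1.
Qed.

Lemma tensor_le_unit_widen (K : fieldType) (n1 n2 n3 r q : nat) (T : tensor K n1 n2 n3) :
  (r <= q)%N -> tensor_le (unit_tensor K q) T -> tensor_le (unit_tensor K r) T.
Proof.
move=> rq [A1 [A2 [A3 e]]]; pose f := widen_ord rq.
have fI : injective f by move=> x y xy; apply: val_inj; apply: (congr1 val xy).
exists (rowsub f A1), (rowsub f A2), (rowsub f A3).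
apply/ffunP => -[[i j] k]; rewrite unit_tensorE -[i == j](inj_eq fI) -[j == k](inj_eq fI).
rewrite -unit_tensorE -e !ffunE.
by apply: eq_bigr => x _; rewrite !mxE.
Qed.

(** Contracting [I_r] with a vector [u] in one direction gives the diagonal
    matrix of [u], so no nonzero [u] can annihilate the rows of [A_d]. *)
Lemma tensor_map_unit_row_free (K : fieldType) (n1 n2 n3 r : nat) (T : tensor K n1 n2 n3)
    (A1 : 'M[K]_(r, n1)) (A2 : 'M[K]_(r, n2)) (A3 : 'M[K]_(r, n3)) :
  tensor_map A1 A2 A3 T = unit_tensor K r -> [/\ row_free A1, row_free A2 & row_free A3].
Proof.
move=> e.
have main (n : nat) (A : 'M[K]_(r, n)) :
    (forall u : 'rV_r, u *m A = 0 -> forall l, u 0 l = 0) -> row_free A.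
  move=> h; rewrite -kermx_eq0; apply/rowV0P => u /sub_kermxP/h u0.
  by apply/rowP => l; rewrite u0 mxE.
split; apply: main => u uA l.
- have <- : tensor_map u 1%:M 1%:M (unit_tensor K r) (0, l, l) = u 0 l.
    rewrite tensor_map_unit (bigD1 l) //= !mxE eqxx !mulr1 big1 ?addr0 // => k kl.
    by rewrite !mxE [l == k]eq_sym (negbTE kl) mulr0.
  rewrite -e tensor_map_comp uA ffunE big1 // => x _.
  by rewrite [(0 : 'M_(_, _)) _ _]mxE !mul0r.
- have <- : tensor_map 1%:M u 1%:M (unit_tensor K r) (l, 0, l) = u 0 l.
    rewrite tensor_map_unit (bigD1 l) //= !mxE eqxx mul1r !mulr1 big1 ?addr0 // => k kl.
    by rewrite !mxE [l == k]eq_sym (negbTE kl) mulr0.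
  rewrite -e tensor_map_comp uA ffunE big1 // => x _.
  by rewrite [(0 : 'M_(_, _)) _ _]mxE mulr0 !mul0r.
- have <- : tensor_map 1%:M 1%:M u (unit_tensor K r) (l, l, 0) = u 0 l.
    rewrite tensor_map_unit (bigD1 l) //= !mxE eqxx !mul1r big1 ?addr0 // => k kl.
    by rewrite !mxE [l == k]eq_sym (negbTE kl) !mul0r.
  rewrite -e tensor_map_comp uA ffunE big1 // => x _.
  by rewrite [(0 : 'M_(_, _)) _ _]mxE mulr0 mul0r.
Qed.

Lemma tensor_le_unit_bound (K : fieldType) (n1 n2 n3 r : nat) (T : tensor K n1 n2 n3) :
  tensor_le (unit_tensor K r) T -> [/\ (r <= n1)%N, (r <= n2)%N & (r <= n3)%N].
Proof.
have bound n (A : 'M[K]_(r, n)) : row_free A -> (r <= n)%N.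
  by move=> /eqP {1}<-; apply: rank_leq_col.
by move=> [A1 [A2 [A3 /tensor_map_unit_row_free[/bound ? /bound ? /bound ?]]]].
Qed.

(** The largest [s] in the definition of the subrank exists since [s <= n1], and
    restriction to unit tensors is inherited by smaller ones. *)
Lemma subrank_geP (K : fieldType) (n1 n2 n3 r : nat) (T : tensor K n1 n2 n3) :
  subrank_ge r T <-> tensor_le (unit_tensor K r) T.
Proof.
split=> [[q [qT _] rq]|]; first exact: tensor_le_unit_widen rq qT.
have [k] := ubnP (n1 - r); elim: k r => // k IH r kr rT.
have [rT'|nrT] := classic (tensor_le (unit_tensor K r.+1) T).
  have [q qT rq] : subrank_ge r.+1 T.
    apply: (IH _ _ rT'); have [rn _ _] := tensor_le_unit_bound rT'.
    by move: kr rn; lia.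
  by exists q => //; apply: ltnW.
exists r => //; split=> // q qT; rewrite leqNgt; apply/negP => rq.
by apply: nrT; apply: tensor_le_unit_widen rq qT.
Qed.

(** * Covering shapes by lines of three directions *)

Definition line_through (S G : finType) (l : 'I_3 -> S -> G) (d : 'I_3) (c : G) : {set S} :=
  [set y | l d y == c].

(** Two lines of different directions share at most one point. *)
Definition jointly_injective (S G : finType) (l : 'I_3 -> S -> G) :=
  forall d e, d != e -> forall x y, l d x = l d y -> l e x = l e y -> x = y.

(** Otherwise a line of direction [d] through a point of [R] has more than [s d]
    points of [R], and the lines of another direction [e] through these points are
    disjoint and have more than [s e] points each.  So [R] has at least
    [(s d + 1) * (s e + 1)] points for all [d != e]; taking for [d] and [e] the
    two largest budgets, this exceeds the sum of all three. *)
Lemma short_line_exists (S G : finType) (l : 'I_3 -> S -> G) (s : 'I_3 -> nat) (R : {set S}) :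
  jointly_injective l -> R != set0 -> (#|R| <= \sum_d s d)%N ->
  exists d c, (0 < #|line_through l d c :&: R| <= s d)%N.
Proof.
move=> lI /set0Pn[x xR] Rs; apply: NNPP => nex.
have long d y : y \in R -> (s d < #|line_through l d (l d y) :&: R|)%N.
  move=> yR; rewrite ltnNge; apply/negP => le; apply: nex; exists d, (l d y).
  by rewrite le andbT card_gt0; apply/set0Pn; exists y; rewrite !inE eqxx.
have grid d e : d != e -> ((s d).+1 * (s e).+1 <= #|R|)%N.
  move=> de; pose L := line_through l d (l d x) :&: R.
  apply: (@leq_trans (\sum_(y in L) #|line_through l e (l e y) :&: R|)).
    apply: (@leq_trans (\sum_(y in L) (s e).+1)).
      by rewrite sum_nat_const leq_mul2r long.
    by apply: leq_sum => y /setIP[_ yR]; apply: long.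
  under eq_bigr do rewrite -sum1_card.
  rewrite (exchange_big_dep (mem R)) /= => [|y z _ /setIP[]//].
  rewrite -sum1_card; apply: leq_sum => z _; rewrite sum1_card.
  apply/card_le1_eqP => y y'; rewrite -!topredE /= !inE.
  move=> /andP[/andP[/eqP dy _] /andP[/eqP ey _]] /andP[/andP[/eqP dy' _] /andP[/eqP ey' _]].
  by apply: (lI _ _ de); rewrite ?dy ?dy' -?ey -?ey'.
move: Rs (grid 0 1 isT) (grid 0 (lift ord0 ord_max) isT) (grid 1 (lift ord0 ord_max) isT).
rewrite !big_ord_recl big_ord0 addn0.
have -> : lift ord0 ord0 = 1 :> 'I_3 by apply: val_inj.
have -> : lift ord0 (lift ord0 ord0) = lift ord0 ord_max :> 'I_3 by apply: val_inj.
move: (s _) (s _) (s _) #|R| => a b c n; nia.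
Qed.

(** The greedy covering of [R] by lines, in a form that forgets the order in which
    lines are taken: [m d c] is the number of points that were new when the line
    [c] of direction [d] was taken.  The set [Z] stands for the shapes on which a
    tensor is known to vanish, and the hypothesis on [Z] is the rule that a quota
    of [m] moment equations clears a line with at most [m] remaining points. *)
Lemma line_quotas (S G : finType) (l : 'I_3 -> S -> G) (s : 'I_3 -> nat) (R : {set S}) :
  jointly_injective l -> (#|R| <= \sum_d s d)%N ->
  exists2 m : 'I_3 -> G -> nat, forall d, (\sum_c m d c <= s d)%N &
    forall Z : {set S}, ~: R \subset Z ->
      (forall d c, (#|line_through l d c :\: Z| <= m d c)%N -> line_through l d c \subset Z) ->
      Z = setT.
Proof.
move=> lI; have [k] := ubnP #|R|; elim: k R s => // k IH R s Rk Rs.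
have [R0|R0] := eqVneq R set0.
  exists (fun _ _ => 0%N) => [d|Z]; first by rewrite big1.
  by rewrite R0 setC0 subTset => /eqP.
have [d [c /andP[n0 ns]]] := short_line_exists lI R0 Rs.
set n := #|_| in n0 ns; pose R' := R :\: line_through l d c.
have cR' : (#|R'| + n = #|R|)%N by rewrite addnC /n setIC cardsID.
have [||m ms hm] := IH R' (fun e => if e == d then s d - n else s e)%N.
- by move: Rk; rewrite -cR'; lia.
- rewrite (bigD1 d) //= eqxx; move: Rs; rewrite -cR' (bigD1 d) //=.
  rewrite [in X in _ -> X](eq_bigr s) => [|e /negbTE->//]; lia.
exists (fun e b => m e b + (if (e == d) && (b == c) then n else 0))%N => [e|Z RZ hZ].
  rewrite big_split /=; move: (ms e); case: eqP => [->|_] /=.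
    by rewrite -big_mkcond big_pred1_eq; lia.
  by rewrite [X in (_ + X)%N]big1 ?addn0.
have lZ : line_through l d c \subset Z.
  apply: hZ; rewrite !eqxx /=; apply: leq_trans (leq_addl _ _).
  apply: subset_leq_card; apply/subsetP => y /setDP[yl yZ].
  by rewrite inE yl; apply: contraR yZ => yR; apply: (subsetP RZ); rewrite inE.
apply: hm => [|e b le]; last by apply: hZ; apply: leq_trans le (leq_addr _ _).
by rewrite setCD subUset RZ lZ.
Qed.

(** Combining the equations, [\sum_j p.[y j] * f j = 0] for each [p] of degree
    less than [m]; the polynomial with roots [y j] for the other [j] in [A]
    isolates [f i]. *)
Lemma vandermonde_sparse (K : fieldType) (I : finType) (y f : I -> K) (A : {set I}) (m : nat) :
  injective y -> (forall i, i \notin A -> f i = 0) -> (#|A| <= m)%N ->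
  (forall t, (t < m)%N -> \sum_i y i ^+ t * f i = 0) -> forall i, f i = 0.
Proof.
move=> yI fA Am mom i; have [iA|/fA//] := boolP (i \in A).
pose p := \prod_(j in A :\ i) ('X - (y j)%:P).
have sp : (size p <= m)%N.
  by rewrite /p -big_enum size_prod_XsubC -cardE; move: Am; rewrite (cardsD1 i) iA.
have : \sum_j p.[y j] * f j = 0.
  under eq_bigr do rewrite horner_coef big_distrl /=.
  rewrite exchange_big big1 //= => t _.
  under eq_bigr do rewrite -mulrA.
  by rewrite -big_distrr /= mom ?mulr0 //; apply: leq_trans sp.
rewrite (bigD1 i) //= big1 => [/eqP|j ji].
  rewrite addr0 mulf_eq0 => /orP[|/eqP//].
  rewrite horner_prod => /prodf_eq0[j]; rewrite !inE => /andP[ji _].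
  by rewrite hornerXsubC subr_eq0 => /eqP/yI e; rewrite e eqxx in ji.
have [jA|/fA->] := boolP (j \in A); last by rewrite mulr0.
rewrite horner_prod (bigD1 j) ?inE ?ji //= hornerXsubC subrr !mul0r //.
Qed.

Lemma infinite_injection (K : fieldType) (n : nat) :
  infinite_field K -> exists y : 'I_n -> K, injective y.
Proof.
move=> hK; have [s us ss] := infinite_uniq_seq n hK.
exists (fun i => nth 0 s i) => i j /eqP; rewrite nth_uniq ?ss //.
by move/eqP/val_inj.
Qed.

Definition triple (A : Type) (a b c : A) (d : 'I_3) : A :=
  match val d with 0 => a | 1 => b | _ => c end.

Lemma sum_triple (a b c : nat) : (\sum_d triple a b c d = a + b + c)%N.
Proof. by rewrite !big_ord_recl big_ord0 /triple /= addn0 addnA. Qed.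

Section Slices.
Variables (K : fieldType) (r : nat) (y : 'I_r.+1 -> K) (m : 'I_r.+1 -> nat).

(** The slots of the slices available in one direction: the slice in slot [(c, t)]
    has the entries [y p ^+ t] on the diagonal [q - p = c]. *)
Definition power_list : seq ('I_r.+1 * nat) :=
  [seq (c, t) | c <- enum 'I_r.+1, t <- iota 0 (m c)].

(** Beyond the last slot the slice is that of the default slot [(0, 0)]; it only
    adds an equation. *)
Definition power_slice (t : nat) (p q : 'I_r.+1) : K :=
  let ct := nth (0, 0%N) power_list t in
  if q - p == ct.1 then y p ^+ ct.2 else 0.

Lemma power_slice_moments (s : nat) (V : 'I_r.+1 -> 'I_r.+1 -> K) :
  (\sum_c m c <= s)%N ->
  (forall t, (t < s)%N -> \sum_p \sum_q power_slice t p q * V p q = 0) ->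
  forall c t, (t < m c)%N -> \sum_p y p ^+ t * V p (p + c) = 0.
Proof.
move=> ms hV c t tm; have mem : (c, t) \in power_list.
  by apply: allpairs_f_dep; rewrite ?mem_enum ?mem_iota.
have lt : (index (c, t) power_list < s)%N.
  apply: leq_trans ms; have := mem; rewrite -index_mem => /leq_trans; apply.
  rewrite size_allpairs_dep sumnE big_map big_enum /=.
  by under eq_bigr do rewrite size_iota.
rewrite -[RHS](hV _ lt); apply: eq_bigr => p _.
rewrite (bigD1 (p + c)) //= big1 ?addr0 /power_slice nth_index //=.
  by rewrite [p + c]addrC addrK eqxx.
by move=> q qc; rewrite subr_eq [c + p]addrC (negbTE qc) mul0r.
Qed.
End Slices.

(** With [s = (j - i, k - i)], the three values are [k - j], [k - i] and [j - i]:
    the coordinates that remain fixed when the slices of direction [0], [1] or [2]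
    are supported on a diagonal. *)
Definition shape_line (r : nat) : 'I_3 -> 'I_r.+1 * 'I_r.+1 -> 'I_r.+1 :=
  fun d s => triple (s.2 - s.1) s.2 s.1 d.

Lemma shape_line_injective (r : nat) : jointly_injective (@shape_line r).
Proof.
move=> d e; case: d => [[|[|[|//]]] ?]; case: e => [[|[|[|//]]] ?] // _ [a b] [a' b'];
rewrite /shape_line /triple /=.
- by move=> + e2; rewrite e2 => /(@addrI _ b') /oppr_inj ->.
- by move=> + e2; rewrite e2 => /(@addIr _ (- a')) ->.
- by move=> e1; rewrite e1 => /(@addrI _ b') /oppr_inj ->.
- by move=> -> ->.
- by move=> e1; rewrite e1 => /(@addIr _ (- a')) ->.
- by move=> -> ->.
Qed.

Lemma card_proper_shapes (r : nat) :
  #|[set s : 'I_r.+1 * 'I_r.+1 | [&& s.1 != 0, s.2 != 0 & s.1 != s.2]]| = (r * r.-1)%N.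
Proof.
rewrite -sum1_card.
rewrite (eq_bigl (fun s : 'I_r.+1 * 'I_r.+1 =>
    (s.1 != 0) && ((s.2 != 0) && (s.1 != s.2)))); last first.
  by move=> s; rewrite inE.
rewrite -(pair_big_dep (fun a : 'I_r.+1 => a != 0)
  (fun a b : 'I_r.+1 => (b != 0) && (a != b)) (fun _ _ => 1%N)) /=.
rewrite (eq_bigr (fun _ => r.-1)) => [|a a0].
  by rewrite sum_nat_const; have := cardC1 (0 : 'I_r.+1); rewrite card_ord => ->.
have r0 : (0 < r)%N by case: (r) a a0 => // a; rewrite ord1 eqxx.
rewrite sum1_card; have := cardC (pred2 0 a); rewrite card2 eq_sym a0 card_ord.
have -> : #|(fun b : 'I_r.+1 => (b != 0) && (a != b))| = #|[predC pred2 0 a]|.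
  by apply: eq_card => b; rewrite -!topredE /= negb_or [a == b]eq_sym.
by move=> h; apply: (@addnI 2); rewrite h add2n prednK.
Qed.

(** * A tensor with nondegenerate slices *)

Definition corner (K : fieldType) (n1 n2 n3 r : nat)
    (h1 : (r <= n1)%N) (h2 : (r <= n2)%N) (h3 : (r <= n3)%N)
    (T : tensor K n1 n2 n3) : tensor K r r r :=
  [ffun x => T (widen_ord h1 x.1.1, widen_ord h2 x.1.2, widen_ord h3 x.2)].

(** The free slices of the three directions, chosen according to the quotas of
    [line_quotas] for the shapes with distinct indices; the bound on [r] says that
    the [n_d - r] together are at least the number [(r - 1)(r - 2)] of these shapes,
    with [r] written as [r.+1]. *)
Lemma nondegenerate_slices (K : fieldType) (r n1 n2 n3 : nat) :
  infinite_field K ->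
  (r.+1 <= n1)%N -> (r.+1 <= n2)%N -> (r.+1 <= n3)%N -> (r.+1 ^ 2 + 2 <= n1 + n2 + n3)%N ->
  exists N : 'I_3 -> nat -> 'I_r.+1 -> 'I_r.+1 -> K,
  forall U : 'I_r.+1 -> 'I_r.+1 -> 'I_r.+1 -> K,
  (forall i j k, [|| i == j, j == k | i == k] -> U i j k = 0) ->
  (forall i t, (t < n1 - r.+1)%N -> \sum_j \sum_k N 0 t j k * U i j k = 0) ->
  (forall j t, (t < n2 - r.+1)%N -> \sum_i \sum_k N 1 t i k * U i j k = 0) ->
  (forall k t, (t < n3 - r.+1)%N -> \sum_i \sum_j N ord_max t i j * U i j k = 0) ->
  forall i j k, U i j k = 0.
Proof.
move=> hK h1 h2 h3 hn; have [y yI] := infinite_injection r.+1 hK.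
pose R : {set 'I_r.+1 * 'I_r.+1} := [set s | [&& s.1 != 0, s.2 != 0 & s.1 != s.2]].
pose s := triple (n1 - r.+1)%N (n2 - r.+1)%N (n3 - r.+1)%N.
have Rs : (#|R| <= \sum_d s d)%N.
  rewrite card_proper_shapes sum_triple; move: hn h1 h2 h3; rewrite -mulnn; clear.
  by case: r => [|q] /=; nia.
have [m ms hm] := line_quotas (@shape_line_injective r) Rs.
exists (fun d => power_slice y (m d)) => U Udiag U1 U2 U3.
pose Z := [set s : 'I_r.+1 * 'I_r.+1 | [forall i, U i (i + s.1) (i + s.2) == 0]].
have zP i j k : (j - i, k - i) \in Z -> U i j k = 0.
  by rewrite inE => /forallP/(_ i)/eqP /=; rewrite ![i + _]addrC !subrK.
(* [sh] parametrizes a line, and the support of [f] injects into its shapes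
   outside [Z], which the quota bounds. *)
have kill d c (sh : 'I_r.+1 -> 'I_r.+1 * 'I_r.+1) (f : 'I_r.+1 -> K) :
    (#|line_through (@shape_line r) d c :\: Z| <= m d c)%N ->
    injective sh -> (forall p, shape_line d (sh p) = c) ->
    (forall p, sh p \in Z -> f p = 0) ->
    (forall t, (t < m d c)%N -> \sum_p y p ^+ t * f p = 0) -> forall p, f p = 0.
  move=> le shI shc shZ; apply: (vandermonde_sparse (A := [set p | sh p \notin Z])) => //.
    by move=> p; rewrite inE negbK => /shZ.
  apply: leq_trans le; rewrite -(card_imset _ shI); apply: subset_leq_card.
  by apply/subsetP => _ /imsetP[p + ->]; rewrite !inE shc eqxx andbT.
have ZT : Z = setT.
  apply: hm => [|d c le].
    apply/subsetP => -[a b]; rewrite !inE /= !negb_and !negbK => ab.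
    apply/forallP => i; apply/eqP/Udiag; move: ab.
    by rewrite -{1}[i]addr0 (inj_eq (addrI i)) -{3}[i]addr0 !(inj_eq (addrI i)) !(eq_sym 0);
      case: eqP; case: eqP; case: eqP.
  apply/subsetP => -[a b]; rewrite inE => /eqP.
  case: d le => [[|[|[|//]]] dP] le; rewrite /shape_line /triple /= => bc;
    rewrite inE; apply/forallP => i; apply/eqP => /=.
  - have -> : i + b = i + a + c by rewrite -bc -addrA [a + _]addrC subrK.
    apply: (kill _ _ (fun p => (p - i, p + c - i)) (fun p => U i p (p + c)) le).
    + by move=> p q /(congr1 fst) /addIr.
    + by move=> p; rewrite /shape_line /triple /= [p + c]addrC -[c + p - i]addrA addrK.
    + by move=> p /zP.
    + apply: (power_slice_moments (V := U i) (ms _)) => t.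
      by rewrite /s /triple /= => /(U1 i); rewrite (_ : Ordinal dP = 0) //; apply: val_inj.
  - rewrite bc.
    apply: (kill _ _ (fun p => (i + a - p, c)) (fun p => U p (i + a) (p + c)) le).
    + by move=> p q /(congr1 fst) /addrI /oppr_inj.
    + by [].
    + by move=> p /= hp; apply: zP; rewrite [p + c]addrC addrK.
    + apply: (power_slice_moments (V := fun p q => U p (i + a) q) (ms _)) => t.
      by rewrite /s /triple /= => /(U2 (i + a)); rewrite (_ : Ordinal dP = 1) //; apply: val_inj.
  - rewrite bc.
    apply: (kill _ _ (fun p => (c, i + b - p)) (fun p => U p (p + c) (i + b)) le).
    + by move=> p q /(congr1 snd) /addrI /oppr_inj.
    + by [].
    + by move=> p /= hp; apply: zP; rewrite [p + c]addrC addrK.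
    + apply: (power_slice_moments (V := fun p q => U p q (i + b)) (ms _)) => t.
      by rewrite /s /triple /= => /(U3 (i + b));
        rewrite (_ : Ordinal dP = ord_max) //; apply: val_inj.
by move=> i j k; apply: zP; rewrite ZT inE.
Qed.

Lemma spanning_by_duality (K : fieldType) (J C : finType) (F : J -> C -> K) :
  (forall U : C -> K, (forall j, \sum_c F j c * U c = 0) -> forall c, U c = 0) ->
  forall W : C -> K, exists b : J -> K, forall c, W c = \sum_j b j * F j c.
Proof.
move=> h W; pose M := \matrix_(j < #|J|, c < #|C|) F (enum_val j) (enum_val c).
have : row_full M.
  rewrite /row_full -mxrank_tr -/(row_free M^T) -kermx_eq0; apply/rowV0P => u /sub_kermxP/rowP uM.
  have u0 := h (fun c => u 0 (enum_rank c)).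
  apply/rowP => c; rewrite mxE -(enum_valK c); apply: u0 => j.
  have := uM (enum_rank j); rewrite !mxE => e; rewrite -[RHS]e.
  rewrite (reindex_onto enum_val enum_rank) => [|x _]; last exact: enum_rankK.
  apply: eq_big => [x|x _]; first by rewrite enum_valK eqxx.
  by rewrite !mxE enum_rankK enum_valK mulrC.
move=> /row_fullP[B BM]; pose b := (\row_c W (enum_val c)) *m B.
exists (fun j => b 0 (enum_rank j)) => c.
have /rowP/(_ (enum_rank c)) : b *m M = \row_c W (enum_val c).
  by rewrite /b -mulmxA BM mulmx1.
rewrite !mxE enum_rankK => <-.
rewrite (reindex_onto enum_rank enum_val) => [|x _]; last exact: enum_valK.
apply: eq_big => [x|x _]; first by rewrite enum_rankK eqxx.
by rewrite [in RHS]/b !mxE !enum_rankK.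
Qed.

Lemma sum_pairE (V : nmodType) (A B : finType) (f : A * B -> V) :
  \sum_x f x = \sum_a \sum_b f (a, b).
Proof. by rewrite pair_bigA; apply: eq_bigr => -[]. Qed.

Lemma sum_tripleE (V : nmodType) (A B C : finType) (f : A * B * C -> V) :
  \sum_x f x = \sum_a \sum_b \sum_c f (a, b, c).
Proof. by rewrite sum_pairE sum_pairE. Qed.

Section Tangent.
Variables (K : fieldType) (n1 n2 n3 r : nat).
Variables (h1 : (r <= n1)%N) (h2 : (r <= n2)%N) (h3 : (r <= n3)%N).
Local Notation w1 := (widen_ord h1).
Local Notation w2 := (widen_ord h2).
Local Notation w3 := (widen_ord h3).

(** The transpose of the derivative of [(A1, A2, A3) |-> corner of
    (A1 (x) A2 (x) A3) X] at the identity is injective: a tensor orthogonal to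
    the image of each slice of [X] in each direction vanishes. *)
Definition nondegenerate (X : tensor K n1 n2 n3) : Prop :=
  forall U : 'I_r -> 'I_r -> 'I_r -> K,
  (forall i a, \sum_j \sum_k X (a, w2 j, w3 k) * U i j k = 0) ->
  (forall j b, \sum_i \sum_k X (w1 i, b, w3 k) * U i j k = 0) ->
  (forall k c, \sum_i \sum_j X (w1 i, w2 j, c) * U i j k = 0) ->
  forall i j k, U i j k = 0.

(** Every change [W] of the corner comes from an infinitesimal change of basis,
    by duality with [nondegenerate]. *)
Lemma tangent_surjective (X : tensor K n1 n2 n3) (W : 'I_r -> 'I_r -> 'I_r -> K) :
  nondegenerate X ->
  exists (B1 : 'M[K]_(r, n1)) (B2 : 'M[K]_(r, n2)) (B3 : 'M[K]_(r, n3)),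
  forall i j k, W i j k = \sum_a B1 i a * X (a, w2 j, w3 k)
     + \sum_b B2 j b * X (w1 i, b, w3 k) + \sum_c B3 k c * X (w1 i, w2 j, c).
Proof.
move=> ndX.
pose F (x : 'I_r * 'I_n1 + 'I_r * 'I_n2 + 'I_r * 'I_n3) (c : 'I_r * 'I_r * 'I_r) : K :=
  match x with
  | inl (inl (i, a)) => if c.1.1 == i then X (a, w2 c.1.2, w3 c.2) else 0
  | inl (inr (j, b)) => if c.1.2 == j then X (w1 c.1.1, b, w3 c.2) else 0
  | inr (k, d) => if c.2 == k then X (w1 c.1.1, w2 c.1.2, d) else 0
  end.
have [|b hb] := @spanning_by_duality K _ _ F _ (fun c => W c.1.1 c.1.2 c.2).
  move=> U hU; suff U0 i j k : U (i, j, k) = 0 by case=> -[i j] k.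
  apply: (ndX (fun i j k => U (i, j, k))) => [{}i a|{}j b|{}k c].
  - rewrite -[RHS](hU (inl (inl (i, a)))) sum_tripleE /=.
    rewrite [RHS](bigD1 i) //= [X in _ = _ + X]big1 ?addr0 => [|i' /negbTE ii].
      by apply: eq_bigr => j' _; apply: eq_bigr => k' _; rewrite eqxx.
    by rewrite big1 // => j' _; rewrite big1 // => k' _; rewrite ii mul0r.
  - rewrite -[RHS](hU (inl (inr (j, b)))) sum_tripleE /=.
    apply: eq_bigr => i' _.
    rewrite [RHS](bigD1 j) //= [X in _ = _ + X]big1 ?addr0 => [|j' /negbTE jj].
      by apply: eq_bigr => k' _; rewrite eqxx.
    by rewrite big1 // => k' _; rewrite jj mul0r.
  - rewrite -[RHS](hU (inr (k, c))) sum_tripleE /=.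
    apply: eq_bigr => i' _; apply: eq_bigr => j' _.
    rewrite [RHS](bigD1 k) //= [X in _ = _ + X]big1 ?addr0 ?eqxx // => k' /negbTE kk.
    by rewrite kk mul0r.
exists (\matrix_(i, a) b (inl (inl (i, a)))), (\matrix_(i, a) b (inl (inr (i, a)))),
  (\matrix_(i, a) b (inr (i, a))) => i j k.
rewrite [LHS](hb (i, j, k)) !big_sumType /=; congr (_ + _ + _).
- rewrite sum_pairE /=.
  rewrite (bigD1 i) //= [X in _ + X]big1 ?addr0 => [|i' /negbTE ii].
    by apply: eq_bigr => a _; rewrite mxE eqxx.
  by rewrite big1 // => a _; rewrite [i == _]eq_sym ii mulr0.
- rewrite sum_pairE /=.
  rewrite (bigD1 j) //= [X in _ + X]big1 ?addr0 => [|i' /negbTE ii].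
    by apply: eq_bigr => a _; rewrite mxE eqxx.
  by rewrite big1 // => a _; rewrite [j == _]eq_sym ii mulr0.
- rewrite sum_pairE /=.
  rewrite (bigD1 k) //= [X in _ + X]big1 ?addr0 => [|i' /negbTE ii].
    by apply: eq_bigr => a _; rewrite mxE eqxx.
  by rewrite big1 // => a _; rewrite [k == _]eq_sym ii mulr0.
Qed.
End Tangent.

(** The three families of free slices occupy disjoint regions outside the corner,
    where exactly one index is at least [r.+1], so they can be prescribed
    independently.  The slices through the corner are those of the unit tensor and
    kill all entries of [U] with two equal indices. *)
Lemma nondegenerate_tensor_exists (K : fieldType) (r n1 n2 n3 : nat)
    (h1 : (r.+1 <= n1)%N) (h2 : (r.+1 <= n2)%N) (h3 : (r.+1 <= n3)%N) :
  infinite_field K -> (r.+1 ^ 2 + 2 <= n1 + n2 + n3)%N ->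
  exists2 X : tensor K n1 n2 n3, corner h1 h2 h3 X = unit_tensor K r.+1 & nondegenerate h1 h2 h3 X.
Proof.
move=> hK hn; have [N hN] := nondegenerate_slices hK h1 h2 h3 hn.
pose s := r.+1.
pose X0 (a b c : nat) : K :=
  match (a < s)%N, (b < s)%N, (c < s)%N with
  | true, true, true => unit_tensor K s (inord a, inord b, inord c)
  | false, true, true => N 0 (a - s)%N (inord b) (inord c)
  | true, false, true => N 1 (b - s)%N (inord a) (inord c)
  | true, true, false => N ord_max (c - s)%N (inord a) (inord b)
  | _, _, _ => 0
  end.
pose X : tensor K n1 n2 n3 := [ffun x : 'I_n1 * 'I_n2 * 'I_n3 => X0 x.1.1 x.1.2 x.2].
have Xc i j k : X (widen_ord h1 i, widen_ord h2 j, widen_ord h3 k) = ((i == j) && (j == k))%:R.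
  by rewrite ffunE /X0 /= !ltn_ord !inord_val unit_tensorE.
have X1 t (lt : (s + t < n1)%N) j k : X (Ordinal lt, widen_ord h2 j, widen_ord h3 k) = N 0 t j k.
  by rewrite ffunE /X0 /= !ltn_ord !inord_val ltnNge leq_addr addKn.
have X2 t (lt : (s + t < n2)%N) j k : X (widen_ord h1 j, Ordinal lt, widen_ord h3 k) = N 1 t j k.
  by rewrite ffunE /X0 /= !ltn_ord !inord_val ltnNge leq_addr addKn.
have X3 t (lt : (s + t < n3)%N) j k :
    X (widen_ord h1 j, widen_ord h2 k, Ordinal lt) = N ord_max t j k.
  by rewrite ffunE /X0 /= !ltn_ord !inord_val ltnNge leq_addr addKn.
exists X; first by apply/ffunP => -[[i j] k]; rewrite ffunE unit_tensorE /= Xc.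
move=> U U1 U2 U3; apply: hN => [i j k|i t lt|j t lt|k t lt].
- have D1 i' l : U i' l l = 0.
    have := U1 i' (widen_ord h1 l); rewrite (bigD1 l) //= [X in _ + X]big1 ?addr0; last first.
      by move=> j' jl; rewrite big1 // => k' _; rewrite Xc eq_sym (negbTE jl) mul0r.
    rewrite (bigD1 l) //= big1 ?addr0 => [|k' kl]; first by rewrite Xc eqxx mul1r.
    by rewrite Xc eqxx eq_sym (negbTE kl) mul0r.
  have D2 j' l : U l j' l = 0.
    have := U2 j' (widen_ord h2 l); rewrite (bigD1 l) //= [X in _ + X]big1 ?addr0; last first.
      by move=> i' il; rewrite big1 // => k' _; rewrite Xc (negbTE il) mul0r.
    rewrite (bigD1 l) //= big1 ?addr0 => [|k' kl]; first by rewrite Xc eqxx mul1r.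
    by rewrite Xc eqxx eq_sym (negbTE kl) mul0r.
  have D3 k' l : U l l k' = 0.
    have := U3 k' (widen_ord h3 l); rewrite (bigD1 l) //= [X in _ + X]big1 ?addr0; last first.
      move=> i' il; rewrite big1 // => j' _; rewrite Xc.
      by case: eqP => [<-|]; rewrite ?(negbTE il) mul0r.
    rewrite (bigD1 l) //= big1 ?addr0 => [|j' jl]; first by rewrite Xc eqxx mul1r.
    by rewrite Xc (negbTE jl) andbF mul0r.
  by case/or3P => /eqP->.
- have lt' : (s + t < n1)%N by rewrite -ltn_subRL.
  by rewrite -[RHS](U1 i (Ordinal lt')); apply: eq_bigr => j _; apply: eq_bigr => k _; rewrite X1.
- have lt' : (s + t < n2)%N by rewrite -ltn_subRL.
  by rewrite -[RHS](U2 j (Ordinal lt')); apply: eq_bigr => i _; apply: eq_bigr => k _; rewrite X2.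
- have lt' : (s + t < n3)%N by rewrite -ltn_subRL.
  by rewrite -[RHS](U3 k (Ordinal lt')); apply: eq_bigr => i _; apply: eq_bigr => j _; rewrite X3.
Qed.

(** * Density of tensors of large subrank *)

Lemma lowest_homogeneous_part (K : fieldType) (n : nat) (q : {mpoly K[n]}) :
  q != 0 -> exists2 d, pihomog mdeg d q != 0 & forall m, m \in msupp q -> (d <= mdeg m)%N.
Proof.
move=> q0; pose P d := has (fun m => mdeg m == d) (msupp q).
have exP : exists d, P d.
  by exists (mdeg (mlead q)); apply/hasP; exists (mlead q); rewrite ?mlead_supp.
case: (ex_minnP exP) => d /hasP[m mq /eqP md] dmin.
exists d => [|m' m'q]; last by apply: dmin; apply/hasP; exists m'.
have dE : pihomog mdeg d q = \sum_(m <- msupp q | mdeg m == d) q@_m *: 'X_[m] by rewrite pihomogE.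
apply/eqP => /(congr1 (mcoeff m)); rewrite mcoeff0 dE raddf_sum /=.
rewrite (big_rem m) //= md eqxx mcoeffZ mcoeffX eqxx mulr1 big1_seq ?addr0.
  by move/eqP; apply/negP; rewrite -mcoeff_msupp.
move=> m' /andP[_]; rewrite mem_rem_uniq ?msupp_uniq // => /andP[/= m'm _].
by rewrite mcoeffZ mcoeffX (negbTE m'm) mulr0.
Qed.

(** A substitute for the statement that a map with surjective differential is
    dominant, valid in every characteristic: if [p] vanishes on [C], substituting
    the curve [x0 + e * g] in the expansion of [p] at [x0] and dividing by the
    lowest power of [e] leaves, at [e = 0], the value at [w] of the lowest
    homogeneous part of that expansion. *)
Lemma dense_of_tangent_curves (K : fieldType) (I : finType)
    (C : {ffun I -> K} -> Prop) (x0 : {ffun I -> K}) :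
  infinite_field K ->
  (forall w : {ffun I -> K}, exists (g : I -> {poly K}) (D : {poly K}),
     [/\ forall i, (g i).[0] = w i, D != 0 &
         forall e, D.[e] != 0 -> C [ffun i => x0 i + e * (g i).[e]]]) ->
  zariski_dense C.
Proof.
move=> hK curve Z [S ZS] CZ x; apply/ZS => p Sp.
have vanish z : C z -> p.@[coords z] = 0 by move=> /CZ/ZS; apply.
apply/eqP/negPn/negP => px.
pose q := p \mPo [tuple 'X_i + (coords x0 i)%:MP | i < #|I|].
have qE h : q.@[h] = p.@[fun i => h i + coords x0 i].
  rewrite /q comp_mpoly_meval; apply: meval_eq => i.
  by rewrite tnth_mktuple mevalD mevalXU mevalC.
have q0 : q != 0.
  apply: contraNneq px => q0; have := qE (fun i => coords x i - coords x0 i).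
  by rewrite q0 meval0 (meval_eq (v2 := coords x)) => [<-|i]; rewrite ?subrK.
have [d hd0 dmin] := lowest_homogeneous_part q0.
have [w] := mpoly_nonvanishing hK hd0.
have [g [D [g0 D0 Cg]]] := curve [ffun i => w (enum_rank i)].
pose Q := \sum_(m <- msupp q)
   q@_m *: ('X^(mdeg m - d) * \prod_(i < #|I|) g (enum_val i) ^+ m i).
have Qe e : e ^+ d * Q.[e] = p.@[coords [ffun i => x0 i + e * (g i).[e]]].
  rewrite -[RHS](@meval_eq _ _
    (fun i : 'I_#|I| => e * (g (enum_val i)).[e] + coords x0 i)); last first.
    by move=> i; rewrite /coords ffunE addrC.
  rewrite -qE mevalE /Q horner_sum big_distrr; apply: eq_big_seq => m mq /=.
  rewrite hornerZ hornerM hornerXn horner_prod mulrCA; congr (_ * _).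
  rewrite mulrA -exprD subnKC ?dmin // mdegE -prodrXr -big_split /=.
  by apply: eq_bigr => i _; rewrite horner_exp exprMn.
have Q0 : Q = 0.
  apply/eqP/negPn/negP => Q0.
  have [|e] := @infinite_nonroot K ('X^d * Q * D) hK.
    by rewrite !mulf_neq0 // -size_poly_eq0 size_polyXn.
  rewrite !hornerM hornerXn mulf_eq0 negb_or Qe => /andP[pe De].
  by rewrite vanish ?eqxx // in pe; apply: Cg.
move/eqP; apply.
have <- : Q.[0] = 0 by rewrite Q0 horner0.
rewrite pihomogE /= raddf_sum /= horner_sum [RHS](bigID (fun m => mdeg m == d)) /=.
rewrite [X in _ + X]big1_seq ?addr0 => [|m /andP[md mq]]; last first.
  have lt : (0 < mdeg m - d)%N by rewrite subn_gt0 ltn_neqAle eq_sym md dmin.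
  by rewrite hornerZ hornerM hornerXn expr0n gtn_eqF // mul0r mulr0.
apply: eq_bigr => m /eqP md.
rewrite mevalZ mevalX hornerZ md subnn expr0 mul1r horner_prod; congr (_ * _).
by apply: eq_bigr => i _; rewrite horner_exp g0 ffunE enum_valK.
Qed.

Lemma tensor_map_left (K : fieldType) (m n1 n2 n3 : nat) (B : 'M[K]_(m, n1))
    (X : tensor K n1 n2 n3) a b c :
  tensor_map B 1%:M 1%:M X (a, b, c) = \sum_i B a i * X (i, b, c).
Proof.
rewrite ffunE sum_tripleE; apply: eq_bigr => i _.
rewrite (bigD1 b) //= (bigD1 c) //= !big1 ?addr0 ?mxE ?eqxx ?mulr1 // => [j jb|k kc].
  by rewrite big1 // => k _; rewrite [1%:M b j]mxE [b == j]eq_sym (negbTE jb) mulr0 !mul0r.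
by rewrite [1%:M c k]mxE [c == k]eq_sym (negbTE kc) mulr0 !mul0r.
Qed.

Lemma tensor_map_middle (K : fieldType) (m n1 n2 n3 : nat) (B : 'M[K]_(m, n2))
    (X : tensor K n1 n2 n3) a b c :
  tensor_map 1%:M B 1%:M X (a, b, c) = \sum_i B b i * X (a, i, c).
Proof.
rewrite ffunE sum_tripleE (bigD1 a) //= [X in _ + X]big1 ?addr0 => [|i ia]; last first.
  rewrite big1 // => j _; rewrite big1 // => k _.
  by rewrite [1%:M a i]mxE [a == i]eq_sym (negbTE ia) !mul0r.
apply: eq_bigr => j _; rewrite (bigD1 c) //= big1 ?addr0 ?mxE ?eqxx ?mul1r ?mulr1 // => k kc.
by rewrite [1%:M c k]mxE [c == k]eq_sym (negbTE kc) mulr0 !mul0r.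
Qed.

Lemma tensor_map_right (K : fieldType) (m n1 n2 n3 : nat) (B : 'M[K]_(m, n3))
    (X : tensor K n1 n2 n3) a b c :
  tensor_map 1%:M 1%:M B X (a, b, c) = \sum_i B c i * X (a, b, i).
Proof.
rewrite ffunE sum_tripleE (bigD1 a) //= [X in _ + X]big1 ?addr0 => [|i ia]; last first.
  rewrite big1 // => j _; rewrite big1 // => k _.
  by rewrite [1%:M a i]mxE [a == i]eq_sym (negbTE ia) !mul0r.
rewrite (bigD1 b) //= [X in _ + X]big1 ?addr0 => [|j jb]; last first.
  by rewrite big1 // => k _; rewrite [1%:M b j]mxE [b == j]eq_sym (negbTE jb) mulr0 !mul0r.
by apply: eq_bigr => k _; rewrite !mxE !eqxx !mul1r.
Qed.

Lemma tensor_map_id (K : fieldType) (n1 n2 n3 : nat) (X : tensor K n1 n2 n3) :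
  tensor_map 1%:M 1%:M 1%:M X = X.
Proof.
apply/ffunP => -[[a b] c]; rewrite tensor_map_left (bigD1 a) //= big1 ?addr0 => [|i ia].
  by rewrite mxE eqxx mul1r.
by rewrite mxE eq_sym (negbTE ia) mul0r.
Qed.

(** The matrix [1 + 'X B], a curve of changes of basis through the identity. *)
Definition line_mx (K : fieldType) (n : nat) (B : 'M[K]_n) : 'M[{poly K}]_n :=
  map_mx polyC 1%:M + 'X *: map_mx polyC B.

Lemma line_mxE (K : fieldType) (n : nat) (B : 'M[K]_n) e a b :
  (line_mx B a b).[e] = (1%:M + e *: B) a b.
Proof. by rewrite !mxE hornerD hornerM hornerX !hornerC. Qed.

Lemma line_mx_deriv (K : fieldType) (n : nat) (B : 'M[K]_n) a b :
  ((line_mx B a b)^`()).[0] = B a b.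
Proof. by rewrite !mxE derivD derivM !derivC derivX !hornerE. Qed.

Lemma line_mx_det (K : fieldType) (n : nat) (B : 'M[K]_n) e :
  (\det (line_mx B)).[e] = \det (1%:M + e *: B).
Proof.
rewrite -[LHS]/(horner_eval e _) -det_map_mx; congr (\det _).
by apply/matrixP => a b; rewrite mxE; apply: line_mxE.
Qed.

Section Curve.
Variables (K : fieldType) (n1 n2 n3 : nat).
Variables (B1 : 'M[K]_n1) (B2 : 'M[K]_n2) (B3 : 'M[K]_n3) (X Y : tensor K n1 n2 n3).

Definition curve (x : 'I_n1 * 'I_n2 * 'I_n3) : {poly K} :=
  \sum_y line_mx B1 x.1.1 y.1.1 * line_mx B2 x.1.2 y.1.2 * line_mx B3 x.2 y.2
    * ((X y)%:P + 'X * (Y y)%:P).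

Lemma curveE e x :
  (curve x).[e] = tensor_map (1%:M + e *: B1) (1%:M + e *: B2) (1%:M + e *: B3)
                    [ffun y => X y + e * Y y] x.
Proof.
rewrite horner_sum ffunE; apply: eq_bigr => y _.
by rewrite !hornerM !line_mxE ffunE hornerD hornerM hornerX !hornerC.
Qed.

Lemma curve0 x : (curve x).[0] = X x.
Proof.
rewrite curveE !scale0r !addr0 -[in RHS](tensor_map_id X) !ffunE.
by apply: eq_bigr => y _; rewrite ffunE mul0r addr0.
Qed.

(** The product rule; this is the derivative of the action of the three groups
    plus the change [Y] of the tensor itself. *)
Lemma curve_tangent x :
  ((curve x)^`()).[0] = tensor_map B1 1%:M 1%:M X x + tensor_map 1%:M B2 1%:M X x
     + tensor_map 1%:M 1%:M B3 X x + Y x.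
Proof.
rewrite -[in Y x](tensor_map_id Y) !ffunE -!big_split raddf_sum horner_sum.
apply: eq_bigr => y _ /=.
rewrite !derivM derivD derivC derivM derivX derivC.
rewrite !(hornerD, hornerM, hornerX, hornerC, line_mxE, line_mx_deriv) !scale0r !addr0.
by ring.
Qed.

Definition curve_direction x : {poly K} := drop_poly 1 (curve x).

Lemma curve_split e x : (curve x).[e] = X x + e * (curve_direction x).[e].
Proof.
rewrite -[in LHS](poly_take_drop 1 (curve x)) hornerD hornerM hornerXn expr1 mulrC.
congr (_ + _); rewrite -(curve0 x) horner_coef0.
by rewrite (_ : take_poly 1 _ = ((curve x)`_0)%:P) ?hornerC //; apply/polyP=> -[|i];
  rewrite coef_take_poly coefC.
Qed.

Lemma curve_direction0 x : (curve_direction x).[0] = ((curve x)^`()).[0].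
Proof. by rewrite !horner_coef0 coef_drop_poly coef_deriv. Qed.
End Curve.

Lemma corner_tensor_map (K : fieldType) (n1 n2 n3 r : nat)
    (h1 : (r <= n1)%N) (h2 : (r <= n2)%N) (h3 : (r <= n3)%N) (X : tensor K n1 n2 n3) :
  corner h1 h2 h3 X =
  tensor_map (rowsub (widen_ord h1) 1%:M) (rowsub (widen_ord h2) 1%:M)
             (rowsub (widen_ord h3) 1%:M) X.
Proof.
apply/ffunP => x; rewrite ffunE -[in LHS](tensor_map_id X) !ffunE.
by apply: eq_bigr => y _; rewrite !mxE.
Qed.

(** Only the first [r] rows of a matrix acting on a tensor affect its corner; the
    others are taken to be zero. *)
Definition extend_rows (K : fieldType) (r n : nat) (B : 'M[K]_(r, n)) : 'M[K]_n :=
  \matrix_(a, b) if insub (val a) is Some i then B i b else 0.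

Lemma extend_rowsE (K : fieldType) (r n : nat) (h : (r <= n)%N) (B : 'M[K]_(r, n)) i b :
  extend_rows B (widen_ord h i) b = B i b.
Proof. by rewrite mxE /= valK. Qed.

(** For a direction [w], the corner of [w] is produced by changes of basis and the
    rest by a tensor [Y] that vanishes on the corner.  Undoing the changes of
    basis, every point of the resulting curve restricts to the unit tensor in the
    corner of [X]. *)
Theorem subrank_ge_dense (K : fieldType) (r n1 n2 n3 : nat) :
  infinite_field K -> (r.+1 <= n1)%N -> (r.+1 <= n2)%N -> (r.+1 <= n3)%N ->
  (r.+1 ^ 2 + 2 <= n1 + n2 + n3)%N -> zariski_dense (@subrank_ge K n1 n2 n3 r.+1).
Proof.
move=> hK h1 h2 h3 hn; have [X cX ndX] := nondegenerate_tensor_exists h1 h2 h3 hK hn.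
apply: (dense_of_tangent_curves (x0 := X)) => // w.
have [b1 [b2 [b3 hb]]] := tangent_surjective
  (fun i j k => w (widen_ord h1 i, widen_ord h2 j, widen_ord h3 k)) ndX.
pose B1 := extend_rows b1; pose B2 := extend_rows b2; pose B3 := extend_rows b3.
pose Y : tensor K n1 n2 n3 := [ffun x => w x - (tensor_map B1 1%:M 1%:M X x
  + tensor_map 1%:M B2 1%:M X x + tensor_map 1%:M 1%:M B3 X x)].
have Y0 i j k : Y (widen_ord h1 i, widen_ord h2 j, widen_ord h3 k) = 0.
  rewrite ffunE hb tensor_map_left tensor_map_middle tensor_map_right; apply/eqP.
  rewrite subr_eq0; apply/eqP; congr (_ + _ + _); apply: eq_bigr => a _;
  by rewrite extend_rowsE.
exists (curve_direction B1 B2 B3 X Y).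
exists (\det (line_mx B1) * \det (line_mx B2) * \det (line_mx B3)); split.
- move=> x; rewrite curve_direction0 curve_tangent [Y x]ffunE.
  by rewrite addrC subrK.
- suff : (\det (line_mx B1) * \det (line_mx B2) * \det (line_mx B3)).[0] != 0.
    by apply: contraNneq => ->; rewrite horner0.
  by rewrite !hornerM !line_mx_det !scale0r !addr0 !det1 !mulr1 oner_neq0.
move=> e; rewrite !hornerM !line_mx_det !mulf_eq0 !negb_or -!unitfE.
move=> /andP[/andP[u1 u2] u3]; apply/subrank_geP.
set M1 := _ + _ in u1; set M2 := _ + _ in u2; set M3 := _ + _ in u3.
exists (rowsub (widen_ord h1) 1%:M *m invmx M1), (rowsub (widen_ord h2) 1%:M *m invmx M2),
  (rowsub (widen_ord h3) 1%:M *m invmx M3).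
have -> : [ffun i => X i + e * (curve_direction B1 B2 B3 X Y i).[e]]
    = tensor_map M1 M2 M3 [ffun y => X y + e * Y y].
  by apply/ffunP => x; rewrite ffunE -curve_split curveE.
rewrite tensor_map_comp !mulmxKV // -corner_tensor_map -cX.
by apply/ffunP => -[[i j] k]; rewrite [LHS]ffunE [RHS]ffunE /= ffunE Y0 mulr0 addr0.
Qed.

(** * Tensors of large subrank in few parameters *)

Definition polynomial_function (K : fieldType) (J : finType) (f : (J -> K) -> K) : Prop :=
  exists p : {mpoly K[#|J|]}, forall y, f y = p.@[fun i => y (enum_val i)].

Section PolynomialFunctions.
Variables (K : fieldType) (J : finType).
Implicit Types f g : (J -> K) -> K.

Lemma polynomial_coord j : polynomial_function (fun y : J -> K => y j).
Proof. by exists 'X_(enum_rank j) => y; rewrite mevalXU enum_rankK. Qed.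

Lemma polynomialB f g : polynomial_function f -> polynomial_function g ->
  polynomial_function (fun y => f y - g y).
Proof. by move=> [p hp] [q hq]; exists (p - q) => y; rewrite mevalB hp hq. Qed.

Lemma polynomialM f g : polynomial_function f -> polynomial_function g ->
  polynomial_function (fun y => f y * g y).
Proof. by move=> [p hp] [q hq]; exists (p * q) => y; rewrite mevalM hp hq. Qed.

Lemma polynomial_sum (A : finType) (P : pred A) (f : A -> (J -> K) -> K) :
  (forall a, polynomial_function (f a)) -> polynomial_function (fun y => \sum_(a | P a) f a y).
Proof.
move=> /fin_all_exists[p hp]; exists (\sum_(a | P a) p a) => y.
by rewrite raddf_sum; apply: eq_bigr => a _; apply: hp.
Qed.
End PolynomialFunctions.

(** Fixing the coordinates in the image of [h] leaves [#|J| - #|U|] free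
    parameters; if these are fewer than the components of [F], the components
    satisfy an algebraic relation. *)
Lemma polynomial_map_dependence (K : fieldType) (I J U : finType) (h : U -> J) (c : U -> K)
    (F : I -> (J -> K) -> K) :
  (forall i, polynomial_function (F i)) -> injective h -> (#|J| < #|I| + #|U|)%N ->
  exists2 P : {mpoly K[#|I|]}, P != 0 &
    forall y, (forall u, y (h u) = c u) -> P.@[fun i => F (enum_val i) y] = 0.
Proof.
move=> /fin_all_exists[p hp] hI lt.
pose free j := j \notin codom h; pose V := {j | free j}.
have cV : (#|{: V}| < #|I|)%N.
  have := cardC (mem (codom h)); rewrite card_codom // -(@ltn_add2l #|U|) [X in (_ < X)%N]addnC.
  move=> e; rewrite card_sig; apply: leq_ltn_trans lt.
  by rewrite -e leq_add2l; apply: subset_leq_card; apply/subsetP.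
pose sub (j : J) : {mpoly K[#|{: V}|]} :=
  if [pick u | h u == j] is Some u then (c u)%:MP
  else if insub j is Some v then 'X_(enum_rank (v : V)) else 0.
pose f (i : 'I_#|I|) := p (enum_val i) \mPo [tuple sub (enum_val j) | j < #|J|].
have [P P0 hP] := algebraic_dependence f cV; exists P => // y hy.
rewrite -[RHS](hP (fun i => y (val (enum_val i)))); apply: meval_eq => i.
rewrite hp /f comp_mpoly_meval; apply: meval_eq => j; rewrite tnth_mktuple /sub.
case: pickP => [u /eqP hu|nu]; first by rewrite mevalC -hu hy.
case: insubP => [v _ vj|]; first by rewrite mevalXU enum_rankK vj.
by rewrite /free negbK => /codomP[u hu]; have := nu u; rewrite -hu eqxx.
Qed.

Definition pivots (n1 n2 n3 r : nat) (f1 : 'I_r -> 'I_n1) (f2 : 'I_r -> 'I_n2)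
  (f3 : 'I_r -> 'I_n3) (x : 'I_r * 'I_r * 'I_r) := (f1 x.1.1, f2 x.1.2, f3 x.2).

(** What [(A1 (x) A2 (x) A3) T = I_r] becomes when each [A_d] is reduced at its
    pivot columns [f_d]: the [E_d] are the reduced matrices and the [G_d], up to
    scaling of their columns, the inverses of the pivot minors.  The positions
    [p] and [q] record where the columns of [G1] and [G2] are normalized to [1]. *)
Definition chart_data (K : fieldType) (n1 n2 n3 r : nat) (f1 : 'I_r -> 'I_n1)
    (f2 : 'I_r -> 'I_n2) (f3 : 'I_r -> 'I_n3) (p q : 'I_r -> 'I_r)
    (T : tensor K n1 n2 n3) : Prop :=
  exists (G1 G2 G3 : 'I_r -> 'I_r -> K)
     (E1 : 'I_r -> 'I_n1 -> K) (E2 : 'I_r -> 'I_n2 -> K) (E3 : 'I_r -> 'I_n3 -> K),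
   [/\ forall l, G1 (p l) l = 1, forall l, G2 (q l) l = 1,
       [/\ forall x i, E1 x (f1 i) = (x == i)%:R,
         forall x i, E2 x (f2 i) = (x == i)%:R &
         forall x i, E3 x (f3 i) = (x == i)%:R] &
       forall x, T (pivots f1 f2 f3 x) = \sum_l G1 x.1.1 l * G2 x.1.2 l * G3 x.2 l
         - \sum_(t | [forall x, pivots f1 f2 f3 x != t])
             E1 x.1.1 t.1.1 * E2 x.1.2 t.1.2 * E3 x.2 t.2 * T t].

(** The parameters [J] are the entries of the [G_d], of the [E_d] and of [T]; those
    indexed by [U] have fixed values in the chart: [2 r] normalized entries, the
    [3 r ^ 2] entries of the [E_d] at pivots, and the [r ^ 3] pivot entries of [T],
    which the chart computes from the rest.  The inequality between [r] and the
    [n_d] is exactly [#|J| - #|U| < n1 * n2 * n3]. *)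
Lemma chart_polynomial (K : fieldType) (n1 n2 n3 r : nat) (f1 : 'I_r -> 'I_n1)
    (f2 : 'I_r -> 'I_n2) (f3 : 'I_r -> 'I_n3) (p q : 'I_r -> 'I_r) :
  injective f1 -> injective f2 -> injective f3 ->
  (0 < r)%N -> (n1 + n2 + n3 < r ^ 2 + 2)%N ->
  exists2 P : {mpoly K[#|{: 'I_n1 * 'I_n2 * 'I_n3}|]}, P != 0 &
    forall T : tensor K n1 n2 n3, chart_data f1 f2 f3 p q T -> P.@[coords T] = 0.
Proof.
move=> I1 I2 I3 r0 hn.
pose JG := ('I_r * 'I_r)%type.
pose J := (JG + JG + JG + ('I_r * 'I_n1 + 'I_r * 'I_n2 + 'I_r * 'I_n3)
  + 'I_n1 * 'I_n2 * 'I_n3)%type.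
pose g1 x l : J := inl (inl (inl (inl (x, l)))).
pose g2 x l : J := inl (inl (inl (inr (x, l)))).
pose g3 x l : J := inl (inl (inr (x, l))).
pose e1 x a : J := inl (inr (inl (inl (x, a)))).
pose e2 x a : J := inl (inr (inl (inr (x, a)))).
pose e3 x a : J := inl (inr (inr (x, a))).
pose tt y : J := inr y.
pose piv := pivots f1 f2 f3.
pose U := ('I_r + 'I_r + (JG + JG + JG) + 'I_r * 'I_r * 'I_r)%type.
pose h (u : U) : J := match u with
  | inl (inl (inl l)) => g1 (p l) l
  | inl (inl (inr l)) => g2 (q l) l
  | inl (inr (inl (inl (x, i)))) => e1 x (f1 i)
  | inl (inr (inl (inr (x, i)))) => e2 x (f2 i)
  | inl (inr (inr (x, i))) => e3 x (f3 i)
  | inr x => tt (piv x)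
  end.
pose c (u : U) : K := match u with
  | inl (inl _) => 1
  | inl (inr (inl (inl (x, i)))) | inl (inr (inl (inr (x, i))))
  | inl (inr (inr (x, i))) => (x == i)%:R
  | inr _ => 0
  end.
(* At a pivot, the coordinate of [T] is expressed by the other parameters. *)
pose F (z : 'I_n1 * 'I_n2 * 'I_n3) (y : J -> K) : K :=
  if [pick x | piv x == z] is Some x then
    \sum_l y (g1 x.1.1 l) * y (g2 x.1.2 l) * y (g3 x.2 l)
    - \sum_(t | [forall x, piv x != t])
        y (e1 x.1.1 t.1.1) * y (e2 x.1.2 t.1.2) * y (e3 x.2 t.2) * y (tt t)
  else y (tt z).
have pF z : polynomial_function (F z).
  rewrite /F; case: pickP => [x _|_]; last exact: polynomial_coord.
  by apply: polynomialB; apply: polynomial_sum => a;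
    repeat (apply: polynomialM || apply: polynomial_coord).
have pivI : injective piv.
  by move=> [[a b] d] [[a' b'] d'] [] /I1-> /I2-> /I3->.
have hI : injective h.
  move=> [[[l|l]|[[[x i]|[x i]]|[x i]]]|[[a b] d]]
    [[[l'|l']|[[[x' i']|[x' i']]|[x' i']]]|[[a' b'] d']] //= [].
  - by move=> _ ->.
  - by move=> _ ->.
  - by move=> -> /I1 ->.
  - by move=> -> /I2 ->.
  - by move=> -> /I3 ->.
  - by move=> /I1 -> /I2 -> /I3 ->.
have [|P P0 hP] := @polynomial_map_dependence K _ J U h c F pF hI.
  rewrite !card_sum !card_prod !card_ord; move: hn; rewrite -mulnn; nia.
exists P => // T [G1 [G2 [G3 [E1 [E2 [E3 [hG1 hG2 [hE1 hE2 hE3] hT]]]]]]].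
pose y (j : J) : K := match j with
  | inl (inl (inl (inl (x, l)))) => G1 x l
  | inl (inl (inl (inr (x, l)))) => G2 x l
  | inl (inl (inr (x, l))) => G3 x l
  | inl (inr (inl (inl (x, a)))) => E1 x a
  | inl (inr (inl (inr (x, a)))) => E2 x a
  | inl (inr (inr (x, a))) => E3 x a
  | inr t => if [forall x, piv x != t] then T t else 0
  end.
rewrite -[RHS](hP y); last first.
  move=> [[[l|l]|[[[x i]|[x i]]|[x i]]]|x] //=.
  by case: ifP => // /forallP/(_ x); rewrite eqxx.
apply: meval_eq => i; rewrite /coords /F; case: pickP => [x /eqP <-|nx].
  rewrite [LHS]hT; congr (_ - _); apply: eq_bigr => t ht.
  by rewrite /= ht.
by rewrite /= (_ : [forall x, _]) //; apply/forallP => x; rewrite nx.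
Qed.

(** If [u] or [v] is zero, so is the product, and [w] can take the zero over. *)
Lemma normalize_rank_one (K : fieldType) (r : nat) (u v w : 'I_r -> K) :
  (0 < r)%N ->
  exists t : ('I_r * 'I_r) * (('I_r -> K) * ('I_r -> K) * ('I_r -> K)),
  [/\ t.2.1.1 t.1.1 = 1, t.2.1.2 t.1.2 = 1 &
      forall x y z, u x * v y * w z = t.2.1.1 x * t.2.1.2 y * t.2.2 z].
Proof.
move=> r0; have [/existsP[p up]|nu] := boolP [exists p, u p != 0]; last first.
  exists ((Ordinal r0, Ordinal r0), ((fun _ => 1), (fun _ => 1), (fun _ => 0))).
  split=> //= x y z; suff -> : u x = 0 by rewrite !mul0r mulr0.
  by apply/eqP; move: nu; rewrite negb_exists => /forallP/(_ x); rewrite negbK.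
have [/existsP[q vq]|nv] := boolP [exists q, v q != 0]; last first.
  exists ((Ordinal r0, Ordinal r0), ((fun _ => 1), (fun _ => 1), (fun _ => 0))).
  split=> //= x y z; suff -> : v y = 0 by rewrite !(mul0r, mulr0).
  by apply/eqP; move: nv; rewrite negb_exists => /forallP/(_ y); rewrite negbK.
exists ((p, q), ((fun x => u x / u p), (fun y => v y / v q), (fun z => w z * u p * v q))).
split=> /= [||x y z]; rewrite ?divff //.
by field; rewrite up vq.
Qed.

(** [G] is the inverse of a nonzero maximal minor of [A]. *)
Lemma row_free_pivots (K : fieldType) (r n : nat) (A : 'M[K]_(r, n)) :
  row_free A -> exists (f : {ffun 'I_r -> 'I_n}) (G : 'M[K]_r),
    injective f /\ forall x i, (G *m A) x (f i) = (x == i)%:R.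
Proof.
move=> fA; have fAT : row_full A^T by rewrite /row_full mxrank_tr.
exists (fullrankfun fAT), (invmx (colsub (fullrankfun fAT) A)).
split=> [|x i]; first exact: fullrankfun_inj.
have u : colsub (fullrankfun fAT) A \in unitmx.
  rewrite -unitmx_tr (_ : _^T = rowsub (fullrankfun fAT) A^T) ?fullrowsub_unit //.
  by apply/matrixP => a b; rewrite !mxE.
have := mulVmx u => /matrixP/(_ x i); rewrite [RHS]mxE => <-.
by rewrite !mxE; apply: eq_bigr => k _; rewrite [in RHS]mxE.
Qed.

(** Applying the [G_d] to [(A1 (x) A2 (x) A3) T = I_r] gives the sum of the
    rank-one tensors of the columns of the [G_d] on the right; on the left, a pivot
    position contributes the corresponding entry of [T] alone. *)
Lemma tensor_le_unit_chart (K : fieldType) (n1 n2 n3 r : nat) (T : tensor K n1 n2 n3) :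
  (0 < r)%N -> tensor_le (unit_tensor K r) T ->
  exists (f1 : {ffun 'I_r -> 'I_n1}) (f2 : {ffun 'I_r -> 'I_n2}) (f3 : {ffun 'I_r -> 'I_n3})
    (p q : {ffun 'I_r -> 'I_r}),
  [/\ injective f1, injective f2, injective f3 & chart_data f1 f2 f3 p q T].
Proof.
move=> r0 [A1 [A2 [A3 eT]]].
have [/row_free_pivots[f1 [G1 [I1 E1]]] /row_free_pivots[f2 [G2 [I2 E2]]]
  /row_free_pivots[f3 [G3 [I3 E3]]]] := tensor_map_unit_row_free eT.
have /fin_all_exists[t ht] l := normalize_rank_one (fun x => G1 x l) (fun x => G2 x l)
  (fun x => G3 x l) r0.
exists f1, f2, f3, [ffun l => (t l).1.1], [ffun l => (t l).1.2]; split=> //.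
exists (fun x l => (t l).2.1.1 x), (fun x l => (t l).2.1.2 x), (fun x l => (t l).2.2 x).
exists (G1 *m A1), (G2 *m A2), (G3 *m A3); split=> // [l|l|x]; try by rewrite ffunE; case: (ht l).
have := congr1 (fun X => tensor_map G1 G2 G3 X x) eT.
rewrite tensor_map_comp tensor_map_unit ffunE => e.
rewrite (eq_bigr (fun l => G1 x.1.1 l * G2 x.1.2 l * G3 x.2 l)) => [|l _]; last first.
  by case: (ht l).
rewrite -{}e.
rewrite (bigID (fun t => [forall x, pivots f1 f2 f3 x != t])) /= addrC addrK.
rewrite (bigD1 (pivots f1 f2 f3 x)) /=; last by apply/forallPn; exists x; rewrite eqxx.
rewrite !E1 !E2 !E3 !eqxx !mul1r big1 ?addr0 // => y /andP[/forallPn[z]].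
rewrite negbK => /eqP<-; rewrite /= !E1 !E2 !E3 => zx.
have [e1|] := eqVneq x.1.1 z.1.1; last by rewrite !mul0r.
have [e2|] := eqVneq x.1.2 z.1.2; last by rewrite mulr0 !mul0r.
have [e3|] := eqVneq x.2 z.2; last by rewrite mulr0 !mul0r.
by case/eqP: zx; rewrite /pivots e1 e2 e3.
Qed.

(** One nonzero polynomial for each of the finitely many charts; their product
    vanishes on all tensors of subrank at least [r]. *)
Theorem subrank_ge_not_dense (K : fieldType) (n1 n2 n3 r : nat) :
  infinite_field K -> (0 < r)%N -> (n1 + n2 + n3 < r ^ 2 + 2)%N ->
  ~ zariski_dense (@subrank_ge K n1 n2 n3 r).
Proof.
move=> hK r0 hn dense.
pose chart := ({ffun 'I_r -> 'I_n1} * {ffun 'I_r -> 'I_n2} * {ffun 'I_r -> 'I_n3}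
  * {ffun 'I_r -> 'I_r} * {ffun 'I_r -> 'I_r})%type.
have /fin_all_exists2[P P0 hP] (ch : chart) : exists2 P : {mpoly K[#|{: 'I_n1 * 'I_n2 * 'I_n3}|]},
    P != 0 & forall T : tensor K n1 n2 n3,
      injective ch.1.1.1.1 -> injective ch.1.1.1.2 -> injective ch.1.1.2 ->
      chart_data ch.1.1.1.1 ch.1.1.1.2 ch.1.1.2 ch.1.2 ch.2 T -> P.@[coords T] = 0.
  case: ch => [[[[f1 f2] f3] p] q] /=.
  have [[I1 [I2 I3]]|nI] := classic (injective f1 /\ injective f2 /\ injective f3).
    by have [P P0 hP] := chart_polynomial K p q I1 I2 I3 r0 hn; exists P => // T _ _ _ /hP.
  by exists 1; rewrite ?oner_neq0 // => T I1 I2 I3; case: nI.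
have : \prod_ch P ch != 0 by apply/prodf_neq0 => ch _.
move=> /(mpoly_nonvanishing hK)[x]; apply/negP; rewrite negbK.
pose Z (T : tensor K n1 n2 n3) := (\prod_ch P ch).@[coords T] = 0.
have ZT : forall T, Z T.
  apply: dense => [|T /subrank_geP/(tensor_le_unit_chart r0)].
    by exists (eq (\prod_ch P ch)) => T; split=> [ZT _ <-|]; last apply.
  move=> [f1 [f2 [f3 [p [q [I1 I2 I3 cT]]]]]].
  by rewrite /Z (bigD1 (f1, f2, f3, p, q)) //= mevalM hP ?mul0r.
have := ZT [ffun i => x (enum_rank i)]; rewrite /Z => <-; apply/eqP/meval_eq => i.
by rewrite /coords ffunE enum_valK.
Qed.

(** * The generic subrank *)

Lemma dense_nonempty (K : fieldType) (I : finType) (C : {ffun I -> K} -> Prop) :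
  zariski_dense C -> exists x, C x.
Proof.
move=> dense; apply: NNPP => nC; apply: (dense (fun _ => False) _ _ [ffun=> 0]).
  exists (fun _ => true) => x; split=> // h.
  by have /eqP := h 1 isT; rewrite meval1 oner_eq0.
by move=> x Cx; apply: nC; exists x.
Qed.

Local Close Scope ring_scope.
Unset Implicit Arguments.

Theorem theorem2p16 (K : fieldType) (hK : infinite_field K)
    (n1 n2 n3 : nat) (hn1 : 0 < n1) (hn2 : 0 < n2) (hn3 : 0 < n3) :
  is_generic_subrank K n1 n2 n3
    (minn n1 (minn n2 (minn n3 (Nat.sqrt (n1 + n2 + n3 - 2))))).
Proof.
have [lo hi] := Nat.sqrt_spec (n1 + n2 + n3 - 2) (Nat.le_0_l _).
split=> [|r dense]; last first.
  have [T /subrank_geP/tensor_le_unit_bound[r1 r2 r3]] := dense_nonempty dense.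
  rewrite !leq_min r1 r2 r3 /= leqNgt; apply/negP => sr.
  apply: (@subrank_ge_not_dense K n1 n2 n3 r hK _ _ dense); first by case: r sr {dense r1 r2 r3}.
  move: lo hi sr; rewrite -mulnn; move: (Nat.sqrt _) => s; nia.
set r := minn _ _.
have [s0 r1 r2 r3 rs] : [/\ 0 < Nat.sqrt (n1 + n2 + n3 - 2), r <= n1, r <= n2, r <= n3
    & r <= Nat.sqrt (n1 + n2 + n3 - 2)].
  by rewrite /r; move: hi; move: (Nat.sqrt _) => s hi; split; nia.
have : 0 < r by rewrite /r !leq_min hn1 hn2 hn3 s0.
case: r r1 r2 r3 rs => // r r1 r2 r3 rs _.
apply: subrank_ge_dense => //; move: lo rs; rewrite -mulnn.
move: (Nat.sqrt _) => s; nia.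
Qed.
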